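(* Let $G$ be a signed graph on the vertex set $[n+1]$. The generating series of the dynamic Kostant partition function of $G$ is $$\sum_{\mathbf{a}\in\mathbb{Z}^{n+1}} K_G^{\mathrm{dyn}}(\mathbf{a})\,\mathbf{x}^{\mathbf{a}}=\prod_{(i,j,-)\in E(G)}(1-x_ix_j^{-1})^{-1}\prod_{(i,j,+)\in E(G)}(1-x_i-x_j)^{-1},$$ where $\mathbf{x}^{\mathbf{a}}=x_1^{a_1}x_2^{a_2}\cdots x_{n+1}^{a_{n+1}}$ and the products run over the edges of $G$ with multiplicity.
   Context: A signed graph $G$ on $[n+1]=\{1,\ldots,n+1\}$ is a finite graph, multiple edges allowed, each edge carrying a sign; an edge between $i<j$ is written $(i,j,-)$ or $(i,j,+)$; a loop always has positive sign and is written $(i,i,+)$. Dynamic integer flows: each positive edge $e=(i,j,+)$, $i\le j$, is regarded as a left half-edge at $i$ and a right half-edge at $j$. A dynamic integer flow on $G$ assigns a nonnegative integer $b(e)$ to each negative edge $e$; to each positive edge $e=(i,j,+)$ a nonnegative integer $b_\ell(e)$ on its left half-edge; and then, after adding $b_\ell(e)$ extra right half-edges (distinguishable from each other and from the original one) incident to $j$ for each such $e$, a nonnegative integer $b_r(e')$ to every right half-edge $e'$, original or extra. Its netflow at vertex $i$ is $$a_i=\sum_{e=(i,j,-)} b(e)+\sum_{e=(i,j,+)} b_\ell(e)+\sum_{e'} b_r(e')-\sum_{e=(g,i,-)}b(e),$$ where the third sum is over all right half-edges $e'$ incident to $i$ (original and extra). $K_G^{\mathrm{dyn}}(\mathbf{a})$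 is the number of dynamic integer flows on $G$ with netflow vector $\mathbf{a}=(a_1,\ldots,a_{n+1})$. The identity is one of formal series, with $(1-x_ix_j^{-1})^{-1}=\sum_{k\ge0}x_i^kx_j^{-k}$ and $(1-x_i-x_j)^{-1}=\sum_{k\ge 0}(x_i+x_j)^k$. *)

(* Defs.v *)
From HB Require Import structures.
From mathcomp Require Import all_boot all_order all_algebra.
From mathcomp Require Import finmap all_classical.

Set Implicit Arguments.
Unset Strict Implicit.
Unset Printing Implicit Defensive.

Import Order.TTheory GRing.Theory Num.Theory.
Local Open Scope classical_set_scope.
Local Open Scope ring_scope.

(* The vertex set [n+1] is ['I_n.+1].  Edges form an abstract finite type, so
   parallel edges (even of the same sign) are distinct; [edge_lt] forbids
   negative loops. *)
Record signed_graph (n : nat) := SignedGraph {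
  edge : finType;
  lend : edge -> 'I_n.+1;
  rend : edge -> 'I_n.+1;
  positive : edge -> bool;
  edge_le : forall e, (lend e <= rend e)%N;
  edge_lt : forall e, ~~ positive e -> (lend e < rend e)%N }.

Definition neg_edge n (G : signed_graph n) := {e : edge G | ~~ positive e}.
Definition pos_edge n (G : signed_graph n) := {e : edge G | positive e}.

(* Right half-edges once [bl e] extra ones have been added for each positive
   edge [e]: [None] is the original half-edge of [e], [Some k] an extra one. *)
Definition right_half n (G : signed_graph n) (bl : pos_edge G -> nat) :=
  {e : pos_edge G & option 'I_(bl e)}.

Record dyn_flow n (G : signed_graph n) := DynFlow {
  bneg : {ffun neg_edge G -> nat};
  bleft : {ffun pos_edge G -> nat};
  bright : {ffun right_half bleft -> nat} }.

Section DynFlowChoice.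
Variables (n : nat) (G : signed_graph n).

Let code := {b : {ffun neg_edge G -> nat} * {ffun pos_edge G -> nat} &
             {ffun right_half b.2 -> nat}}.

Let encode (f : dyn_flow G) : code :=
  existT (fun b : {ffun neg_edge G -> nat} * {ffun pos_edge G -> nat} =>
            {ffun right_half b.2 -> nat}) (bneg f, bleft f) (bright f).

Let decode (c : code) : dyn_flow G :=
  @DynFlow n G (projT1 c).1 (projT1 c).2 (projT2 c).

Let encodeK : cancel encode decode. Proof. by case. Qed.

HB.instance Definition _ := Choice.copy (dyn_flow G) (can_type encodeK).

End DynFlowChoice.

Definition netflow n (G : signed_graph n) (f : dyn_flow G) : 'rV[int]_n.+1 :=
  \row_i (\sum_(e | lend (val e) == i) (bneg f e)%:Z
          + \sum_(e | lend (val e) == i) (bleft f e)%:Z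
          + \sum_(h : right_half (bleft f) | rend (val (tag h)) == i)
              (bright f h)%:Z
          - \sum_(e | rend (val e) == i) (bneg f e)%:Z).

Definition flows_with n (G : signed_graph n) (a : 'rV[int]_n.+1) :
  set (dyn_flow G) := [set f | netflow f = a].
Arguments flows_with [n] G a.

(* [fset_set] is the empty set on infinite sets, but [flows_with G a] is always
   finite, see [finite_flows_with] below. *)
Definition Kdyn n (G : signed_graph n) (a : 'rV[int]_n.+1) : nat :=
  #|` fset_set (flows_with G a)|%fset.

(* Formal series in x_1^{+-1}, ..., x_{n+1}^{+-1} with integer coefficients:
   [f a] is the coefficient of x^a. *)
Definition series n := 'rV[int]_n.+1 -> int.

Section Series.
Variable n : nat.
Implicit Types (f g : series n) (a b : 'rV[int]_n.+1) (i j : 'I_n.+1).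

Definition xexp i : 'rV[int]_n.+1 := delta_mx 0 i.

Definition smono a : series n := fun b => (b == a)%:R.

Definition sone : series n := smono 0.

Definition sadd f g : series n := fun a => f a + g a.

(* [\sum_(_ \in _)] sums a finitely supported family and is 0 on any other one;
   [smul_summable], [neg_factor_summable] and [pos_factor_summable] below show
   that the latter case never occurs in the products considered here. *)
Definition smul f g : series n :=
  fun a => \sum_(b \in [set: 'rV[int]_n.+1]) f b * g (a - b).

Definition spow f (k : nat) : series n := iter k (smul f) sone.

Definition ssum (F : nat -> series n) : series n :=
  fun a => \sum_(k \in [set: nat]) F k a.

(* (1 - x_i x_j^-1)^-1 *)
Definition neg_factor i j : series n :=
  ssum (fun k => smono ((xexp i - xexp j) *+ k)).

(* (1 - x_i - x_j)^-1 *)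
Definition pos_factor i j : series n :=
  ssum (spow (sadd (smono (xexp i)) (smono (xexp j)))).

End Series.

Definition Kdyn_series n (G : signed_graph n) : series n :=
  fun a => (Kdyn G a)%:Z.

(* The rest of the file shows that the sums and cardinals above are finite.
   All series involved are supported on the exponents with nonnegative partial
   sums, which form a pointed cone. *)

Definition psum n (a : 'rV[int]_n.+1) (k : nat) : int :=
  \sum_(i < n.+1 | (i < k)%N) a 0 i.

Definition in_cone n (a : 'rV[int]_n.+1) := forall k, 0 <= psum a k.

Definition cone_supported n (f : series n) := forall a, f a != 0 -> in_cone a.

Section Finiteness.
Variable n : nat.
Implicit Types (f g : series n) (a b : 'rV[int]_n.+1) (i j : 'I_n.+1).

Lemma psumD a b k : psum (a + b) k = psum a k + psum b k.
Proof. by rewrite /psum -big_split; apply: eq_bigr => i _; rewrite mxE. Qed.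

Lemma psumN a k : psum (- a) k = - psum a k.
Proof. by rewrite /psum -sumrN; apply: eq_bigr => i _; rewrite mxE. Qed.

Lemma psum0 k : psum (0 : 'rV[int]_n.+1) k = 0.
Proof. by rewrite /psum big1 // => i _; rewrite mxE. Qed.

Lemma psum_xexp i k : psum (xexp i) k = (i < k)%N%:R.
Proof.
rewrite /psum big_mkcond (bigD1 i) //= big1 ?addr0 => [|j nji].
  by rewrite !mxE !eqxx; case: ifP.
by rewrite !mxE (negbTE nji) andbF; case: ifP.
Qed.

Lemma entry_psum a i : a 0 i = psum a i.+1 - psum a i.
Proof.
rewrite /psum (bigD1 i) //= -[LHS]addr0 -addrA; congr (_ + _).
apply/esym/eqP; rewrite subr_eq0; apply/eqP/eq_bigl => j.
by rewrite ltnS ltn_neqAle andbC.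
Qed.

Lemma in_cone0 : in_cone (0 : 'rV[int]_n.+1).
Proof. by move=> k; rewrite psum0. Qed.

Lemma in_coneD a b : in_cone a -> in_cone b -> in_cone (a + b).
Proof. by move=> ca cb k; rewrite psumD addr_ge0. Qed.

Lemma finite_box (M : nat) :
  finite_set [set b : 'rV[int]_n.+1 | forall i, `|b 0 i| <= M%:Z].
Proof.
pose h (t : {ffun 'I_n.+1 -> 'I_(M + M).+1}) : 'rV[int]_n.+1 :=
  \row_i ((t i : nat)%:Z - M%:Z).
apply: (@sub_finite_set _ _ (h @` setT)); last exact/finite_image/finite_finset.
move=> b bM /=; exists [ffun i => inord `|(b 0 i + M%:Z)%R|%N] => //.
apply/rowP => i; rewrite mxE ffunE.
have := bM i; rewrite ler_norml => /andP[lb ub].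
have b0 : 0 <= b 0 i + M%:Z by rewrite -lerBlDr sub0r.
rewrite inordK; first by rewrite gez0_abs // addrK.
by rewrite ltnS -lez_nat gez0_abs // PoszD lerD2r.
Qed.

Lemma finite_cone_split a :
  finite_set [set b | in_cone b /\ in_cone (a - b)].
Proof.
pose M := (\sum_(k < n.+2) `|psum a k|)%N.
apply: sub_finite_set (@finite_box M) => b [cb cab] i /=.
have bnd k : (k < n.+2)%N -> 0 <= psum b k <= M%:Z.
  move=> kn; rewrite cb /=; have := cab k.
  rewrite psumD psumN subr_ge0 => /le_trans; apply.
  apply: le_trans (ler_norm _) _; rewrite -abszE lez_nat /M.
  by rewrite (bigD1 (Ordinal kn)) //= leq_addr.
have /andP[l1 u1] := bnd _ (ltn_ord (lift ord0 i)).
have /andP[l2 u2] := bnd _ (ltn_ord (widen_ord (leqnSn _) i)).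
rewrite entry_psum ler_norml; move: l1 u1 l2 u2; rewrite lift0 /= => l1 u1 l2 u2.
rewrite lerBlDr lerBrDr; apply/andP; split.
  by apply: le_trans l1; rewrite addrC subr_le0.
by apply: le_trans u1 _; rewrite lerDl.
Qed.

Lemma smul_summable f g a : cone_supported f -> cone_supported g ->
  finite_set [set b | f b * g (a - b) != 0].
Proof.
move=> cf cg; apply: sub_finite_set (finite_cone_split a) => b /=.
by rewrite mulf_eq0 negb_or => /andP[/cf ? /cg ?].
Qed.

Lemma fsum_neq0 (T : choiceType) (F : T -> int) :
  \sum_(t \in [set: T]) F t != 0 -> exists t, F t != 0.
Proof.
move=> nz; apply: contrapT => /forallNP F0; move/eqP: nz; apply; apply: fsbig1 => t _.
exact/eqP/negPn/negP/F0.
Qed.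

Lemma smul_neq0 f g a : smul f g a != 0 ->
  exists b, f b != 0 /\ g (a - b) != 0.
Proof.
by case/fsum_neq0 => b; rewrite mulf_eq0 negb_or => /andP[? ?]; exists b.
Qed.

Lemma smono_neq0 a b : smono a b != 0 -> b = a.
Proof. by rewrite /smono pnatr_eq0 eqb0 negbK => /eqP. Qed.

Lemma sone_cone : cone_supported (@sone n).
Proof. by move=> a /smono_neq0 ->; exact: in_cone0. Qed.

Lemma smul_cone f g : cone_supported f -> cone_supported g ->
  cone_supported (smul f g).
Proof.
move=> cf cg a /smul_neq0[b [/cf cb /cg cab]].
by rewrite -(subrK b a); exact: in_coneD.
Qed.

Lemma big_smul_cone (I : finType) (P : pred I) (F : I -> series n) :
  (forall e, P e -> cone_supported (F e)) ->
  cone_supported (\big[@smul n/@sone n]_(e | P e) F e).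
Proof.
move=> cF; elim/big_ind: _ => //; first exact: sone_cone.
exact: smul_cone.
Qed.

Lemma neg_factor_summable i j a : (i < j)%N ->
  finite_set [set k | smono ((xexp i - xexp j) *+ k) a != 0].
Proof.
move=> ij; apply: sub_finite_set (finite_set1 `|(a 0 i)%R|%N) => k /= /smono_neq0 ->.
have nij : (i == j) = false by rewrite -val_eqE ltn_eqF.
rewrite mulmxnE !mxE !eqxx nij /= subr0.
by rewrite -[_ *+ k]/(k%:R) natz.
Qed.

Lemma neg_factor_cone i j : (i < j)%N -> cone_supported (neg_factor i j).
Proof.
move=> ij a /fsum_neq0[k /smono_neq0 ->]; elim: k => [|k IH].
  by rewrite mulr0n; exact: in_cone0.
rewrite mulrS; apply: in_coneD => // l.
rewrite psumD psumN !psum_xexp subr_ge0 ler_nat.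
by case: (ltnP j l) => // jl; rewrite (ltn_trans ij jl).
Qed.

Let lin i j : series n := sadd (smono (xexp i)) (smono (xexp j)).

Lemma lin_neq0 i j a : lin i j a != 0 -> a = xexp i \/ a = xexp j.
Proof.
rewrite /lin /sadd => nz; have [/smono_neq0->|] := boolP (smono (xexp i) a != 0).
  by left.
by rewrite negbK => /eqP z; move: nz; rewrite z add0r => /smono_neq0; right.
Qed.

Lemma lin_cone i j : cone_supported (lin i j).
Proof. by move=> a /lin_neq0[] -> k; rewrite psum_xexp ler0n. Qed.

Lemma spow_cone f k : cone_supported f -> cone_supported (spow f k).
Proof.
by move=> cf; elim: k => [|k IH]; [exact: sone_cone|exact: smul_cone].
Qed.

Lemma spow_lin_degree i j k a : spow (lin i j) k a != 0 -> psum a n.+1 = k%:Z.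
Proof.
elim: k a => [|k IH] a /=; first by move/smono_neq0->; rewrite psum0.
case/smul_neq0 => b [/lin_neq0 bE /IH].
rewrite psumD psumN => /eqP; rewrite subr_eq => /eqP ->.
by case: bE => ->; rewrite psum_xexp ltn_ord -addn1 PoszD.
Qed.

Lemma pos_factor_summable i j a :
  finite_set [set k | spow (sadd (smono (xexp i)) (smono (xexp j))) k a != 0].
Proof.
apply: sub_finite_set (finite_set1 `|psum a n.+1|%N) => k /=.
by move/spow_lin_degree->.
Qed.

Lemma pos_factor_cone i j : cone_supported (pos_factor i j).
Proof. by move=> a /fsum_neq0[k]; apply: spow_cone; exact: lin_cone. Qed.

End Finiteness.

Section FiniteFlows.
Variables (n : nat) (G : signed_graph n).

Lemma finite_bounded_ffun (T : finType) (M : nat) :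
  finite_set [set g : {ffun T -> nat} | forall t, (g t <= M)%N].
Proof.
pose h (t : {ffun T -> 'I_M.+1}) : {ffun T -> nat} := [ffun x => t x : nat].
apply: (@sub_finite_set _ _ (h @` setT)); last exact/finite_image/finite_finset.
move=> g gM /=; exists [ffun t => inord (g t)] => //.
by apply/ffunP => t; rewrite !ffunE inordK // ltnS.
Qed.

Lemma psum_fibers (T : finType) (v : T -> 'I_n.+1) (F : T -> int) k :
  \sum_(i < n.+1 | (i < k)%N) \sum_(t | v t == i) F t =
  \sum_(t | (v t < k)%N) F t.
Proof.
rewrite (exchange_big_dep (fun t => (v t < k)%N)) /=; last first.
  by move=> i t ik /eqP->.
apply: eq_bigr => t vk; rewrite (bigD1 (v t)) ?vk ?eqxx //= big1 ?addr0 //.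
by move=> i /andP[/andP[_ /eqP->]]; rewrite eqxx.
Qed.

Lemma psum_netflow (f : dyn_flow G) k : psum (netflow f) k =
  \sum_(e : neg_edge G | (lend (val e) < k <= rend (val e))%N) (bneg f e)%:Z
  + \sum_(e | (lend (val e) < k)%N) (bleft f e)%:Z
  + \sum_(h : right_half (bleft f) | (rend (val (tag h)) < k)%N)
      (bright f h)%:Z.
Proof.
rewrite /psum.
under eq_bigr do rewrite mxE.
rewrite !big_split /= sumrN.
rewrite (psum_fibers (fun e : neg_edge G => lend (val e))).
rewrite (psum_fibers (fun e : pos_edge G => lend (val e))).
rewrite (psum_fibers (fun h : right_half (bleft f) => rend (val (tag h)))).
rewrite (psum_fibers (fun e : neg_edge G => rend (val e))).
rewrite addrAC; congr (_ + _); rewrite addrAC; congr (_ + _).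
rewrite (bigID (fun e : neg_edge G => (rend (val e) < k)%N)) /= addrAC.
rewrite [X in X - _](eq_bigl (fun e : neg_edge G => (rend (val e) < k)%N)).
  rewrite subrr add0r; apply: eq_bigl => e.
  by rewrite -leqNgt.
move=> e /=; rewrite andb_idl // => /(leq_ltn_trans _); apply.
exact: edge_le.
Qed.

Lemma finite_flows_with (a : 'rV[int]_n.+1) : finite_set (flows_with G a).
Proof.
pose M := (\sum_(k < n.+2) `|psum a k|)%N.
have psM k : (k < n.+2)%N -> psum a k <= M%:Z.
  move=> kn; apply: le_trans (ler_norm _) _; rewrite -abszE lez_nat /M.
  by rewrite (bigD1 (Ordinal kn)) //= leq_addr.
have le_sum (T : finType) (P : pred T) (F : T -> nat) t : P t ->
    (F t)%:Z <= \sum_(t | P t) (F t)%:Z.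
  by move=> Pt; rewrite (bigD1 t) //= lerDl sumr_ge0.
pose bounded (T : finType) := [set g : {ffun T -> nat} | forall t, (g t <= M)%N].
apply: (@sub_finite_set _ _ (\bigcup_(bn in bounded (neg_edge G))
  \bigcup_(bl in bounded (pos_edge G))
    (@DynFlow n G bn bl @` bounded (right_half bl)))); last first.
  apply: bigcup_finite => [|bn _]; first exact: finite_bounded_ffun.
  apply: bigcup_finite => [|bl _]; first exact: finite_bounded_ffun.
  exact/finite_image/finite_bounded_ffun.
case=> bn bl br; rewrite /flows_with /= => fa.
have psE k := psum_netflow (DynFlow bn br) k; rewrite fa /= in psE.
exists bn => [e|]; last exists bl => [e|]; last exists br => // h.
- have lt2 : ((lend (val e)).+1 < n.+2)%N by rewrite ltnS.
  rewrite -lez_nat; apply: le_trans (psM _ lt2); rewrite psE -addrA.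
  apply: ler_wpDr; first by rewrite ?addr_ge0 ?sumr_ge0.
  by apply: (@le_sum _ _ (fun e => bn e)); rewrite ltnSn /= edge_lt ?(valP e).
- rewrite -lez_nat; apply: le_trans (psM n.+1 _) => //; rewrite psE.
  rewrite -addrA addrCA; apply: ler_wpDr; first by rewrite ?addr_ge0 ?sumr_ge0.
  exact: (@le_sum _ _ (fun e => bl e)).
- rewrite -lez_nat; apply: le_trans (psM n.+1 _) => //; rewrite psE addrC.
  apply: ler_wpDr; first by rewrite ?addr_ge0 ?sumr_ge0.
  exact: (@le_sum _ _ (fun h => br h)).
Qed.

End FiniteFlows.

(* Main.v *)
Require Import Defs.
From mathcomp Require Import all_boot all_order all_algebra.
From mathcomp Require Import finmap all_classical.

Set Implicit Arguments.
Unset Strict Implicit.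
Unset Printing Implicit Defensive.

Import Order.TTheory GRing.Theory Num.Theory.
Local Open Scope classical_set_scope.
Local Open Scope ring_scope.

(** Both sides are generating series of weighted sets, that is, series whose
    coefficient of [x^a] is the number of objects of weight [a]. The left side
    enumerates the dynamic flows by netflow.

    Such series multiply as expected: the product of the series of [A] and [B]
    is the series of [A `*` B] with the weights added ([wseriesX]), provided that
    the weights have finite fibers and lie in the cone of exponents with
    nonnegative partial sums ([cone_weight]). Iterating over a finite set of
    indices, a product of series is the series of the families of objects
    ([big_wseries]). It remains to see that each factor enumerates the possible
    flows on one edge and that a dynamic flow is a free choice of these.

    For a negative edge the factor is by definition the series of the natural
    numbers [k], of weight [k] times the exponent of [x_i x_j^-1]. For a positive
    edge, [(x_i + x_j)^k] enumerates the words of length [k] in two letters, so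
    the factor enumerates all words ([pos_factor_words]). A word with [p] letters
    [x_i] is given by the lengths of the [p + 1] runs of letters [x_j] that these
    separate ([word_weight_gaps]); likewise a flow on the edge consists of a value
    [p] on the left half-edge and of values on the [p + 1] right half-edges, and
    its netflow is the exponent of the word. The runs thus encode the flow
    ([pos_factor_gaps]), and dynamic flows are in bijection with families of such
    data over all edges ([flow_of_dataK], [data_of_flowK]), with netflow the sum
    of the weights ([netflow_flow_of_data]). *)

(** * Generating series of weighted sets *)

Section WeightedSeries.
Variable n : nat.
Implicit Types a b : 'rV[int]_n.+1.

Definition wseries (T : choiceType) (A : set T) (w : T -> 'rV[int]_n.+1) :
  series n := fun a => \sum_(t \in A) smono (w t) a.

(** The finite fibers make the coefficients of [wseries A w] actual counts, as
    infinite sums are read as 0; the cone makes products of such series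
    well-behaved. *)
Definition cone_weight (T : choiceType) (A : set T) (w : T -> 'rV[int]_n.+1) :=
  (forall t, A t -> in_cone (w t)) /\
  (forall a, finite_set (A `&` w @^-1` [set a])).

Lemma finite_cone_weight (T : choiceType) (A : set T) w C :
  cone_weight A w -> finite_set C -> finite_set (A `&` w @^-1` C).
Proof.
move=> [_ finw] finC.
apply: sub_finite_set (bigcup_finite finC (fun a _ => finw a)) => t [At Ct].
by exists (w t).
Qed.

Lemma wseries_neq0 (T : choiceType) (A : set T) w a :
  wseries A w a != 0 -> exists2 t, A t & w t = a.
Proof.
move=> /(@fsbigN1 _ _ _ _ _ _ (fun a t => smono (w t) a) a)[t At].
by move=> /smono_neq0 ->; exists t.
Qed.

Lemma wseries_cone (T : choiceType) (A : set T) w :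
  cone_weight A w -> cone_supported (wseries A w).
Proof. by move=> [cw _] a /wseries_neq0[t At <-]; exact: cw. Qed.

Lemma wseries_fiber (T : choiceType) (A : set T) w (C : set 'rV[int]_n.+1) a :
  C a -> wseries A w a = \sum_(t \in A `&` w @^-1` C) smono (w t) a.
Proof.
move=> Ca; symmetry; apply: fsbig_widen => [t []//|t [At nC]] /=.
apply/eqP/negPn/negP => /smono_neq0 E; apply: nC; split => //.
by rewrite /preimage /= -E.
Qed.

Definition cone_splits a : set 'rV[int]_n.+1 :=
  [set b | in_cone b /\ in_cone (a - b)].

(** The finiteness behind every product below: an exponent has only finitely
    many decompositions into two exponents of the cone, so that only finitely
    many objects of each kind contribute to a given coefficient of a product. *)
Lemma fiberX_sub (T U : choiceType) (A : set T) (B : set U) w v a :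
  cone_weight A w -> cone_weight B v ->
  (A `*` B) `&` (fun x => w x.1 + v x.2) @^-1` [set a] `<=`
  (A `&` w @^-1` cone_splits a) `*`
  (B `&` v @^-1` ((fun b => a - b) @` cone_splits a)).
Proof.
move=> [cw _] [cv _] [t u] [[/= At Bu] E].
have Et : a - w t = v u by rewrite -E addrC addKr.
have Ct : cone_splits a (w t) by split; [exact: cw|rewrite Et; exact: cv].
by split; split => //; exists (w t).
Qed.

Lemma cone_weightX (T U : choiceType) (A : set T) (B : set U) w v :
  cone_weight A w -> cone_weight B v ->
  cone_weight (A `*` B) (fun x => w x.1 + v x.2).
Proof.
move=> cw cv; split=> [[t u] [/= At Bu]|a].
  by apply: in_coneD; [exact: cw.1|exact: cv.1].
apply: (sub_finite_set (fiberX_sub cw cv)).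
have finC : finite_set (cone_splits a) := finite_cone_split a.
apply: finite_setX; first exact: finite_cone_weight.
exact/finite_cone_weight/finite_image.
Qed.

(** The product formula for generating series. Restricting all index sets to
    those that matter for the coefficient of [x^a] makes the sums finite, after
    which they may be exchanged; the sum over the exponent [b] of the first
    factor then has the single nonzero term [b = w t]. *)
Lemma wseriesX (T U : choiceType) (A : set T) (B : set U) w v :
  cone_weight A w -> cone_weight B v ->
  smul (wseries A w) (wseries B v) =
  wseries (A `*` B) (fun x => w x.1 + v x.2).
Proof.
move=> cw cv; apply/funext => a; rewrite /smul.
pose C := cone_splits a.
have finC : finite_set C := finite_cone_split a.
pose D := (fun b => a - b) @` C.
have finA : finite_set (A `&` w @^-1` C) by exact: finite_cone_weight.
have finB : finite_set (B `&` v @^-1` D).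
  exact/finite_cone_weight/finite_image.
rewrite -(@fsbig_widen _ _ _ _ C) //=; last first.
  move=> b [_ nC] /=; apply/eqP/negPn/negP.
  rewrite mulf_eq0 negb_or => /andP[/(wseries_cone cw) cb].
  by move=> /(wseries_cone cv) cab; exact: nC.
transitivity (\sum_(b \in C) \sum_(t \in A `&` w @^-1` C)
    \sum_(u \in B `&` v @^-1` D) smono (w t) b * smono (v u) (a - b)).
  apply: eq_fsbigr => b; rewrite inE => Cb.
  rewrite (wseries_fiber A w Cb) (@wseries_fiber _ B v D); last by exists b.
  rewrite mulr_fsuml; apply: eq_fsbigr => t _.
  by rewrite mulr_fsumr.
transitivity (\sum_(t \in A `&` w @^-1` C) \sum_(u \in B `&` v @^-1` D)
    smono (w t + v u) a).
  rewrite exchange_fsbig //; apply: eq_fsbigr => t; rewrite inE => -[At Ct].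
  rewrite exchange_fsbig //; apply: eq_fsbigr => u _.
  rewrite (fsbigD1 (w t)) //= fsbig1 => [|b [_ /eqP/negPf nb]]; last first.
    by rewrite /smono nb mul0r.
  by rewrite /smono eqxx mul1r addr0 subr_eq [v u + _]addrC.
rewrite pair_fsbig //=; apply: fsbig_widen => [x [[? _] [? _]]//|].
move=> x [ABx nC] /=; apply/eqP/negPn/negP => /smono_neq0 E.
by apply: nC; apply: (fiberX_sub cw cv).
Qed.

Lemma wseries_bij (T U : choiceType) (A : set T) (B : set U) h w :
  set_bij A B h -> wseries B w = wseries A (w \o h).
Proof.
by move=> hb; apply/funext => a; rewrite /wseries (reindex_fsbig h A).
Qed.

Lemma eq_wseries (T : choiceType) (A : set T) w v :
  (forall t, A t -> w t = v t) -> wseries A w = wseries A v.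
Proof.
move=> E; apply/funext => a; apply: eq_fsbigr => t; rewrite inE => At.
by rewrite E.
Qed.

Lemma cone_weight_surj (T U : choiceType) (A : set T) (B : set U) h w v :
  set_surj A B h -> (forall t, A t -> v (h t) = w t) ->
  cone_weight A w -> cone_weight B v.
Proof.
move=> hs E [cw finw]; split.
  by move=> u /hs[t At <-]; rewrite E //; exact: cw.
move=> a; apply: sub_finite_set (finite_image h (finw a)) => u [/hs[t At <-]].
by rewrite /preimage /= E // => wa; exists t.
Qed.

Lemma wseries1 (T : choiceType) (t : T) (w : T -> 'rV[int]_n.+1) :
  wseries [set t] w = smono (w t).
Proof. by apply/funext => a; rewrite /wseries fsbig_set1. Qed.

Lemma cone_weight1 (T : choiceType) (t : T) (w : T -> 'rV[int]_n.+1) :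
  in_cone (w t) -> cone_weight [set t] w.
Proof.
move=> ct; split=> [_ ->//|a].
by apply: sub_finite_set (finite_set1 t) => x [].
Qed.

(** The product formula iterated over a finite index set. The product [smul] is
    not a monoid law on arbitrary series (associativity needs summability), so
    the big operator is computed by induction on the list of indices. *)
Section Families.
Variables (I : finType) (T : choiceType) (t0 : T).
Variable w : I -> T -> 'rV[int]_n.+1.
Hypothesis cw : forall e, cone_weight [set: T] (w e).

(** The families with a free choice at the indices in [r]. The default [t0]
    elsewhere lets all stages of the induction live in the same type. *)
Let fam (r : seq I) : set {ffun I -> T} :=
  [set g | forall e, e \notin r -> g e = t0].

Let fweight (r : seq I) (g : {ffun I -> T}) := \sum_(e <- r) w e (g e).

Let ins e (x : T * {ffun I -> T}) : {ffun I -> T} :=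
  [ffun e' => if e' == e then x.1 else x.2 e'].

Let ins_bij e r : e \notin r ->
  set_bij ([set: T] `*` fam r) (fam (e :: r)) (ins e).
Proof.
move=> er; split.
- move=> [t g] [_ /= gr] e'; rewrite inE negb_or ffunE => /andP[/negPf-> ?].
  exact: gr.
- move=> [t g] [t' g']; rewrite !inE /= => -[_ gr] [_ gr'] /ffunP E.
  have := E e; rewrite !ffunE eqxx /= => ->; congr pair; apply/ffunP => e'.
  have := E e'; rewrite !ffunE; case: eqP => // -> _ /=.
  by rewrite gr // gr'.
- move=> g gr; exists (g e, [ffun e' => if e' == e then t0 else g e']).
    split=> // e' /= er'; rewrite ffunE; case: eqP => // /eqP ne.
    by apply: gr; rewrite inE negb_or ne.
  by apply/ffunP => e'; rewrite !ffunE /=; case: eqP => // ->.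
Qed.

Let ins_weight e r x : e \notin r ->
  fweight (e :: r) (ins e x) = w e x.1 + fweight r x.2.
Proof.
move=> er; rewrite /fweight big_cons ffunE eqxx; congr (_ + _).
apply: eq_big_seq => e' e'r; rewrite ffunE; case: eqP => // ee.
by rewrite -ee e'r in er.
Qed.

Let big_fam r : uniq r -> cone_weight (fam r) (fweight r) /\
  \big[@smul n/@sone n]_(e <- r) wseries [set: T] (w e) =
  wseries (fam r) (fweight r).
Proof.
elim: r => [_|e r IH /= /andP[er ur]].
  have -> : fam [::] = [set [ffun => t0]].
    apply/seteqP; split=> [g gt|_ -> e _] /=; last by rewrite ffunE.
    by apply/ffunP => e; rewrite ffunE gt.
  have w0 : fweight [::] [ffun => t0] = 0 by rewrite /fweight big_nil.
  rewrite big_nil wseries1 w0; split=> //.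
  by apply: cone_weight1; rewrite w0; exact: in_cone0.
have [cr Er] := IH ur; have ib := ins_bij er; split.
  apply: (cone_weight_surj (h := ins e)) (cone_weightX (cw e) cr).
    by case: ib.
  by move=> x _; rewrite ins_weight.
rewrite big_cons Er wseriesX // (wseries_bij _ ib).
by apply: eq_wseries => x _ /=; rewrite ins_weight.
Qed.

Lemma big_wseries :
  \big[@smul n/@sone n]_(e : I) wseries [set: T] (w e) =
  wseries [set: {ffun I -> T}] (fun g => \sum_e w e (g e)).
Proof.
have [_ ->] := big_fam (index_enum_uniq I); congr wseries.
by apply/seteqP; split=> // g _ e; rewrite mem_index_enum.
Qed.

Lemma cone_weight_ffun :
  cone_weight [set: {ffun I -> T}] (fun g => \sum_e w e (g e)).
Proof.
have [+ _] := big_fam (index_enum_uniq I); congr cone_weight.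
by apply/seteqP; split=> // g _ e; rewrite mem_index_enum.
Qed.

End Families.

End WeightedSeries.

(** * The factors of the product *)

(** True for a bare operation such as [smul], as the enumeration of a subtype is
    by construction the filtered enumeration of the ambient type. *)
Lemma big_subtype (R : Type) (idx : R) (op : R -> R -> R) (I : finType)
    (P : pred I) (F : I -> R) :
  \big[op/idx]_(e | P e) F e = \big[op/idx]_(e : {e | P e}) F (val e).
Proof.
rewrite -big_filter -(big_map val xpredT F); congr bigop.
rewrite [index_enum I]unlock [in RHS]/index_enum ![in RHS]unlock.
rewrite -[RHS]/(map val (pmap (insub : I -> option {e | P e}) (Finite.enum I))).
rewrite pmap_filter; last exact: insubK.
by apply: seq.eq_filter => e; rewrite /= isSome_insub.
Qed.

Section EdgeFactors.
Variable n : nat.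
Implicit Types (a b : 'rV[int]_n.+1) (i j : 'I_n.+1).

Lemma neg_factorE i j :
  neg_factor i j = wseries [set: nat] (fun k => (xexp i - xexp j) *+ k).
Proof. by []. Qed.

Lemma cone_weight_neg_factor i j : (i < j)%N ->
  cone_weight [set: nat] (fun k => (xexp i - xexp j) *+ k).
Proof.
move=> ij; split=> [k _|a].
  elim: k => [|k IH]; first by rewrite mulr0n; exact: in_cone0.
  rewrite mulrS; apply: in_coneD => // l.
  rewrite psumD psumN !psum_xexp subr_ge0 ler_nat.
  by case: (ltnP j l) => // jl; rewrite (ltn_trans ij jl).
apply: sub_finite_set (neg_factor_summable a ij) => k [_ /= <-].
by rewrite /smono eqxx.
Qed.

(** The series [(1 - x_i - x_j)^-1] enumerates the words in the two letters
    [x_i] (encoded by [true]) and [x_j] (encoded by [false]). *)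
Definition letter i j (c : bool) : 'rV[int]_n.+1 :=
  if c then xexp i else xexp j.
Definition word_weight i j (s : seq bool) := \sum_(c <- s) letter i j c.

Definition words k : set (seq bool) := [set s | size s = k].

Lemma finite_words k : finite_set (words k).
Proof.
apply: (@sub_finite_set _ _ ((fun t : k.-tuple bool => val t) @` setT)).
  by move=> s /eqP sk; exists (Tuple sk).
exact/finite_image/finite_finset.
Qed.

(** The total degree of the monomial of a word is its length; this is why each
    monomial occurs in only one power of [x_i + x_j]. *)
Lemma psum_word_weight i j s : psum (word_weight i j s) n.+1 = (size s)%:Z.
Proof.
elim: s => [|c s IH]; first by rewrite /word_weight big_nil psum0.
rewrite /word_weight big_cons psumD IH /letter.
by case: c; rewrite psum_xexp ltn_ord intS.
Qed.

Lemma in_cone_word_weight i j s : in_cone (word_weight i j s).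
Proof.
rewrite /word_weight; elim/big_ind: _ => [||c _].
- exact: in_cone0.
- by move=> a b; exact: in_coneD.
- by rewrite /letter; case: c => k; rewrite psum_xexp.
Qed.

Lemma cone_weight_words i j A : cone_weight A (word_weight i j).
Proof.
split=> [s _|a]; first exact: in_cone_word_weight.
apply: sub_finite_set (finite_words `|psum a n.+1|%N) => s [_ /= <-].
by rewrite /words /= psum_word_weight.
Qed.

Lemma cone_weight_letter i j : cone_weight [set: bool] (letter i j).
Proof.
split=> [c _|a]; last exact/finite_setIl/finite_finset.
by rewrite /letter; case: c => k; rewrite psum_xexp.
Qed.

Lemma linear_wseries i j :
  sadd (smono (xexp i)) (smono (xexp j)) = wseries [set: bool] (letter i j).
Proof.
apply/funext => a; rewrite /wseries /sadd.
rewrite (fsbigTE [fset true; false]%fset) => [|[]]; rewrite ?inE //=.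
by rewrite big_fsetU1 ?inE //= big_seq_fset1.
Qed.

(** Expanding the power: a word of length [k.+1] is a letter and a word of
    length [k]. *)
Lemma spow_linear i j k :
  spow (sadd (smono (xexp i)) (smono (xexp j))) k =
  wseries (words k) (word_weight i j).
Proof.
elim: k => [|k IH].
  have -> : words 0 = [set [::]].
    by apply/seteqP; split=> [s /size0nil//|s ->].
  by rewrite wseries1 /word_weight big_nil.
rewrite /spow iterS -/(spow _ k) IH linear_wseries wseriesX; last 2 first.
- exact: cone_weight_letter.
- exact: cone_weight_words.
rewrite (@wseries_bij _ _ _ ([set: bool] `*` words k) (words k.+1)
  (fun x => x.1 :: x.2)); last first.
  split=> [[c s] [_ /= <-]//|[c s] [c' s'] _ _ /= [-> ->]//|[|c s]//= [sk]].
  by exists (c, s).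
by apply: eq_wseries => x _; rewrite /= /word_weight big_cons.
Qed.

Lemma pos_factor_words i j :
  pos_factor i j = wseries [set: seq bool] (word_weight i j).
Proof.
apply/funext => a; pose d := `|psum a n.+1|%N.
have size_eq s : smono (word_weight i j s) a != 0 -> size s = d.
  by move/smono_neq0 => E; rewrite /d E psum_word_weight.
rewrite /pos_factor /ssum -(@fsbig_widen _ _ _ _ [set d]) //=; last first.
  move=> k [_ kd] /=; rewrite spow_linear; apply/eqP/negPn/negP.
  move=> /wseries_neq0[s sk E]; apply: kd.
  by rewrite /= -sk /d -E psum_word_weight.
rewrite fsbig_set1 spow_linear /wseries; apply: fsbig_widen => // s [_ sd] /=.
by apply/eqP/negPn/negP => /size_eq.
Qed.

(** * Words and flows on a positive edge *)

(** A flow on a positive edge amounts to the value of the original right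
    half-edge, here the first component, and the list of the values of the extra
    ones, whose length is the value of the left half-edge. These values are the
    numbers of letters [x_j] before, between and after the letters [x_i] of the
    corresponding word. Recording the values in a list rather than as a function
    on half-edges keeps the type free of dependencies. *)
Definition word_of_gaps (g : nat * seq nat) : seq bool :=
  nseq g.1 false ++ flatten [seq true :: nseq m false | m <- g.2].

Fixpoint gaps_of_word (s : seq bool) : nat * seq nat :=
  if s is c :: s' then
    let: (m, r) := gaps_of_word s' in if c then (0%N, m :: r) else (m.+1, r)
  else (0%N, [::]).

Lemma gaps_of_wordK : cancel gaps_of_word word_of_gaps.
Proof.
elim=> //= c s; case: (gaps_of_word s) => m r /= IH.
by case: c; rewrite /word_of_gaps /= -IH.
Qed.

Lemma word_of_gapsK : cancel word_of_gaps gaps_of_word.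
Proof.
have nseqE m s : gaps_of_word (nseq m false ++ s) =
    ((m + (gaps_of_word s).1)%N, (gaps_of_word s).2).
  elim: m => [|m IH] /=; first by case: (gaps_of_word s).
  by rewrite IH.
case=> m r; rewrite /word_of_gaps /= nseqE.
suff -> : gaps_of_word (flatten [seq true :: nseq m false | m <- r]) = (0%N, r).
  by rewrite addn0.
by elim: r => //= k r IH; rewrite nseqE IH /= addn0.
Qed.

Definition gap_weight i j (g : nat * seq nat) : 'rV[int]_n.+1 :=
  xexp i *+ size g.2 + xexp j *+ (g.1 + sumn g.2).

Lemma word_weight_gaps i j g :
  word_weight i j (word_of_gaps g) = gap_weight i j g.
Proof.
have nseqE m : word_weight i j (nseq m false) = xexp j *+ m.
  by rewrite /word_weight big_nseq iter_addr_0.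
have catE s s' :
    word_weight i j (s ++ s') = word_weight i j s + word_weight i j s'.
  by rewrite /word_weight big_cat.
case: g => m r; rewrite /word_of_gaps /gap_weight catE nseqE /= mulrnDr addrCA.
congr (_ + _); elim: r => [|k r IH] /=.
  by rewrite /word_weight big_nil !mulr0n addr0.
rewrite -cat_cons catE IH {1}/word_weight big_cons -/(word_weight i j _) nseqE.
by rewrite mulrS mulrnDr -!addrA; congr (_ + _); rewrite addrCA.
Qed.

Lemma pos_factor_gaps i j :
  pos_factor i j = wseries [set: nat * seq nat] (gap_weight i j).
Proof.
rewrite pos_factor_words (@wseries_bij _ _ _ setT setT word_of_gaps).
  by apply: eq_wseries => g _; rewrite /= word_weight_gaps.
rewrite setTT_bijective; exists gaps_of_word.
- exact: word_of_gapsK.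
- exact: gaps_of_wordK.
Qed.

Lemma cone_weight_gaps i j : cone_weight [set: nat * seq nat] (gap_weight i j).
Proof.
apply: (cone_weight_surj (h := gaps_of_word)) (cone_weight_words i j setT).
  by move=> g _; exists (word_of_gaps g) => //; exact: word_of_gapsK.
by move=> s _; rewrite -word_weight_gaps gaps_of_wordK.
Qed.

End EdgeFactors.

(** * Dynamic flows as families of edge data *)

Lemma big_option (R : Type) (idx : R) (op : Monoid.com_law idx) (I : finType)
    (F : option I -> R) :
  \big[op/idx]_o F o = op (F None) (\big[op/idx]_i F (Some i)).
Proof.
rewrite (bigD1 None) //= (reindex_omap Some id) /=; last by case.
by congr (op _ _); apply: eq_bigl => i; rewrite eqxx.
Qed.

Section Flows.
Variables (n : nat) (G : signed_graph n).

Lemma Kdyn_seriesE : Kdyn_series G = wseries [set: dyn_flow G] (@netflow n G).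
Proof.
apply/funext => a; rewrite /Kdyn_series /Kdyn /wseries.
rewrite card_fset_sum1 -(@fsbig_widen _ _ _ _ (flows_with G a)) //=; last first.
  by move=> f [_ nf] /=; apply/eqP/negPn/negP => /smono_neq0 E; apply: nf.
rewrite fsbig_finite /=; last exact: finite_flows_with.
rewrite -natz natr_sum big_seq [RHS]big_seq; apply: eq_bigr => f.
rewrite in_fset_set; last exact: finite_flows_with.
by rewrite inE /flows_with /= /smono => ->; rewrite eqxx.
Qed.

Local Notation edge_data :=
  ({ffun neg_edge G -> nat} * {ffun pos_edge G -> nat * seq nat})%type.

Definition flow_of_data (d : edge_data) : dyn_flow G :=
  @DynFlow n G d.1 [ffun e => size (d.2 e).2]
    [ffun h : right_half [ffun e => size (d.2 e).2] =>
       if tagged h is Some k then nth 0%N (d.2 (tag h)).2 k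
       else (d.2 (tag h)).1].

Definition data_of_flow (f : dyn_flow G) : edge_data :=
  (bneg f,
   [ffun e => (bright f (existT _ e None),
      [seq bright f (existT _ e (Some k)) | k <- enum 'I_(bleft f e)])]).

Lemma bright_original d e :
  bright (flow_of_data d) (existT _ e None) = (d.2 e).1.
Proof. exact: ffunE. Qed.

Lemma bright_extra d e (k : 'I_(bleft (flow_of_data d) e)) :
  bright (flow_of_data d) (existT _ e (Some k)) = nth 0%N (d.2 e).2 k.
Proof. exact: ffunE. Qed.

Lemma bleft_flow_of_data d e : bleft (flow_of_data d) e = size (d.2 e).2.
Proof. exact: ffunE. Qed.

Lemma map_nth_enum (s : seq nat) m : m = size s ->
  [seq nth 0%N s (val k) | k <- enum 'I_m] = s.
Proof.
move=> ->; rewrite (map_comp (nth 0%N s) val) val_enum_ord.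
exact: mkseq_nth.
Qed.

Lemma flow_of_dataK : cancel flow_of_data data_of_flow.
Proof.
move=> d; rewrite [RHS]surjective_pairing; congr pair; apply/ffunP => e.
rewrite ffunE bright_original [RHS]surjective_pairing; congr pair.
rewrite -[RHS](map_nth_enum (bleft_flow_of_data d e)).
by apply: eq_map => k; rewrite bright_extra.
Qed.

(** The type of [bright] depends on [bleft], and the round trip through
    [edge_data] gives back [bleft] only up to a propositional equality; comparing
    the extra half-edges by their ranks avoids a transport along it. *)
Lemma eq_dyn_flow bn (bl bl' : {ffun pos_edge G -> nat})
    (br : {ffun right_half bl -> nat}) (br' : {ffun right_half bl' -> nat}) :
  bl = bl' ->
  (forall e, br (existT _ e None) = br' (existT _ e None)) ->
  (forall e (k : 'I_(bl e)) (k' : 'I_(bl' e)), k = k' :> nat ->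
     br (existT _ e (Some k)) = br' (existT _ e (Some k'))) ->
  DynFlow bn br = DynFlow bn br'.
Proof.
move=> E; move: br'; rewrite -E => br' EN ES; congr DynFlow.
by apply/ffunP => -[e [k|]]; [exact: ES|exact: EN].
Qed.

Lemma data_of_flowK : cancel data_of_flow flow_of_data.
Proof.
case=> bn bl br; apply: eq_dyn_flow => [|e|e k k' kk'].
- by apply/ffunP => e; rewrite !ffunE /= size_map size_enum_ord.
- by apply: etrans (bright_original _ e) _; rewrite ffunE.
- apply: etrans (bright_extra k) _.
  rewrite ffunE /= kk' (nth_map k') ?size_enum_ord //.
  by rewrite nth_ord_enum.
Qed.

(** The netflow is a sum of contributions of the single edges, because each
    extra half-edge belongs to the positive edge that created it. *)
Lemma netflow_flow_of_data d : netflow (flow_of_data d) =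
  \sum_e (xexp (lend (val e)) - xexp (rend (val e))) *+ d.1 e +
  \sum_e gap_weight (lend (val e)) (rend (val e)) (d.2 e).
Proof.
have netE (J : finType) (v : J -> 'I_n.+1) (F : J -> nat) i :
    \sum_(e | v e == i) (F e)%:Z = \sum_e (xexp (v e) *+ F e) 0 i.
  rewrite big_mkcond; apply: eq_bigr => e _; rewrite mulmxnE mxE eqxx eq_sym /=.
  by case: eqP => _ /=; rewrite ?mul0rn // -natz.
apply/rowP => i; rewrite !mxE !summxE.
have rightE : \sum_(h : right_half (bleft (flow_of_data d)) |
      rend (val (tag h)) == i) (bright (flow_of_data d) h)%:Z =
    \sum_e (xexp (rend (val e)) *+ ((d.2 e).1 + sumn (d.2 e).2)) 0 i.
  rewrite -netE.
  rewrite (eq_bigr (fun e => \sum_(o : option 'I_(bleft (flow_of_data d) e))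
      (bright (flow_of_data d) (existT _ e o))%:Z)).
    rewrite sig_big_dep /=.
    by apply: eq_big => [[e o]|[e o] _] //=; rewrite andbT.
  move=> e _; under eq_bigr do rewrite -natz.
  rewrite -natr_sum natz; congr Posz.
  rewrite big_option bright_original /=; congr (_ + _)%N.
  rewrite -[in LHS](map_nth_enum (bleft_flow_of_data d e)).
  rewrite sumnE big_map big_enum /=.
  by apply: eq_bigr => k _; rewrite -bright_extra.
rewrite rightE !netE addrAC [X in X + _]addrAC -addrA -sumrB; congr (_ + _).
  by apply: eq_bigr => e _; rewrite mulrnBl !mxE.
rewrite -big_split; apply: eq_bigr => e _ /=.
by rewrite bleft_flow_of_data /gap_weight mxE.
Qed.

End Flows.

Theorem proposition6p21 (n : nat) (G : signed_graph n) :
  Kdyn_series G =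
  smul (\big[@smul n/@sone n]_(e : edge G | ~~ positive e)
          neg_factor (lend e) (rend e))
       (\big[@smul n/@sone n]_(e : edge G | positive e)
          pos_factor (lend e) (rend e)).
Proof.
rewrite [X in smul X _]big_subtype [X in smul _ X]big_subtype Kdyn_seriesE.
have cneg (e : neg_edge G) := cone_weight_neg_factor (edge_lt (valP e)).
have cpos (e : pos_edge G) := cone_weight_gaps (lend (val e)) (rend (val e)).
rewrite (eq_bigr _ (fun (e : neg_edge G) _ =>
  neg_factorE (lend (val e)) (rend (val e)))).
rewrite (eq_bigr _ (fun (e : pos_edge G) _ =>
  pos_factor_gaps (lend (val e)) (rend (val e)))).
rewrite (big_wseries 0%N cneg) (big_wseries (0%N, [::]) cpos).
rewrite (wseriesX (cone_weight_ffun 0%N cneg)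
  (cone_weight_ffun (0%N, [::]) cpos)).
rewrite (@wseries_bij _ _ _ ([set: _] `*` [set: _]) setT (@flow_of_data n G)).
  by apply: eq_wseries => d _; exact: netflow_flow_of_data.
rewrite setXTT setTT_bijective.
by exists (@data_of_flow n G); [exact: flow_of_dataK|exact: data_of_flowK].
Qed.
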